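(* Every instance of 1D-PMCLP-PC-QoS has an optimal solution $\mathbf{x}^*=(x^*_{s_1},\ldots,x^*_{s_p})\in\mathbb{R}^p$ for which there is a non-repetitive sequence $s_{t_1},s_{t_2},\ldots,s_{t_p}$ of the service zones such that $x^*_{s_{t_1}}\in X_{ID}^{z_{s_{t_1}}}$ and, for $k=2,\ldots,p$, $$x^*_{s_{t_k}}\in X_{ID}^{z}\cup\mathcal{X}_{OS}^{z}(T_k),$$ where $z=\xi^1_{s_{t_k}}$, $T_k=\{t_1,\ldots,t_{k-1}\}$, and $t_k\in P$.
   Context: **Problem 1D-PMCLP-PC-QoS.** Let $\mathcal{D}=\{d_1,\ldots,d_n\}$ be a set of $n$ (possibly overlapping) line segments on the $x$-axis, called demand zones (DZs), where $d_i=[x_{d_i},x_{d_i}+w_{d_i}]$ has known left end point $x_{d_i}$ and width $w_{d_i}$, and a base reward rate per unit length $v_i\in\mathbb{R}_+$. The base service zone $s_0$ is a line segment of known width $w_{s_0}$. There are $p$ service zones (SZs) $\mathcal{S}=\{s_1,\ldots,s_p\}$; let $P=\{1,\ldots,p\}$. Each SZ $s\in\mathcal{S}$ has a single fixed scaling factor (QoS) $z_s=\xi^1_s\ge 1$ (i.e. $\Xi_s=\{\xi^1_s\}$), which may differ between SZs, and it is the segment $[x_s,x_s+\xi^1_s w_{s_0}]$, where the left end point $x_s\in\mathbb{R}$ is to be chosen. The reward rate (per unit length) for covering part of $d_i$ by an SZ with scaling factor $z$ is $v_i^z=v_i/\eta(z)\le v_i$, where $\eta$ is a given strictly increasing function.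 Partial coverage is allowed. The problem is to maximize over $\mathbf{x}=(x_{s_1},\ldots,x_{s_p})\in\mathbb{R}^p$ $$f(\mathbf{x})=\sum_{i=1}^n\mathcal{T}_i\Big(d_i\cap\big(\textstyle\bigcup_{j=1}^p s_j\big)\Big),$$ where $\mathcal{T}_i$ returns the total reward captured from $d_i$ by $s_1,\ldots,s_p$. A part of $d_i$ covered by several SZs is rewarded once, at the rate corresponding to the best QoS (smallest scaling factor) among the SZs covering it. **Inner DZ critical values.** For a scaling factor $z$, $$X_{ID}^z=\bigcup_{i=1}^n\{x_{d_i},\,x_{d_i}+w_{d_i}-w_{s_0}z\}.$$ **Outer SZ critical values.** For a scaling factor $z$ and a set $\mathcal{J}\subset P$ of indices of positioned SZs (with left end points $x_{s_j}$ and scaling factors $z_{s_j}=\xi^1_{s_j}$), $$\mathcal{X}_{OS}^z(\mathcal{J})=\bigcup_{j\in\mathcal{J}}\{x_{s_j}-w_{s_0}z,\;x_{s_j}+w_{s_0}z_{s_j}\}.$$ In the theorem these sets are formed from the positions of the optimal solution, i.e. with $x_{s_j}=x^*_{s_j}$. *)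

(* Defs.v *)
From HB Require Import structures.
From mathcomp Require Import all_boot all_order all_algebra.
From mathcomp Require Import all_classical all_reals all_analysis.

Set Implicit Arguments.
Unset Strict Implicit.
Unset Printing Implicit Defensive.

Import Order.TTheory GRing.Theory Num.Theory.
Import numFieldNormedType.Exports.

Local Open Scope classical_set_scope.
Local Open Scope ring_scope.

(* [n] demand zones and [p] service zones; [scale j] is the only admissible
   scaling factor of service zone [j].  Scaling factors are at least 1, so
   [eta] is only constrained on the half-line z >= 1; its values are positive
   there because it divides reward rates. *)
Record instance (R : realType) (n p : nat) := Instance {
  dz_left : 'I_n -> R;
  dz_width : 'I_n -> R;
  dz_width_ge0 : forall i, 0 <= dz_width i;
  base_rate : 'I_n -> R;
  base_rate_ge0 : forall i, 0 <= base_rate i;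
  base_width : R;
  base_width_ge0 : 0 <= base_width;
  scale : 'I_p -> R;
  scale_ge1 : forall j, 1 <= scale j;
  eta : R -> R;
  eta_gt0 : forall z, 1 <= z -> 0 < eta z;
  eta_increasing : forall y z, 1 <= y -> y < z -> eta y < eta z;
  rate_le : forall i z, 1 <= z -> base_rate i / eta z <= base_rate i
}.

Section Problem.
Variables (R : realType) (n p : nat) (I : instance R n p).

Definition demand_zone (i : 'I_n) : set R :=
  `[dz_left I i, dz_left I i + dz_width I i]%classic.

Definition service_zone (x : 'I_p -> R) (j : 'I_p) : set R :=
  `[x j, x j + scale I j * base_width I]%classic.

Definition rate (i : 'I_n) (z : R) : R := base_rate I i / eta I z.

(* The infimum of a finite set, hence a minimum wherever some service zone
   covers [u]; elsewhere the value is not used. *)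
Definition best_scale (x : 'I_p -> R) (u : R) : R :=
  inf [set scale I j | j in [set j | service_zone x j u]].

Definition captured_reward (x : 'I_p -> R) (i : 'I_n) : R :=
  \int[@lebesgue_measure R]_(u in
      demand_zone i `&` \bigcup_j service_zone x j) rate i (best_scale x u).

Definition total_reward (x : 'I_p -> R) : R := \sum_(i < n) captured_reward x i.

Definition optimal (x : 'I_p -> R) : Prop :=
  forall y : 'I_p -> R, total_reward y <= total_reward x.

Definition inner_DZ_critical (z : R) : set R :=
  \bigcup_i [set dz_left I i; dz_left I i + dz_width I i - base_width I * z].

Definition outer_SZ_critical (x : 'I_p -> R) (J : set 'I_p) (z : R) : set R :=
  \bigcup_(j in J)
    [set x j - base_width I * z; x j + base_width I * scale I j].

End Problem.

(* Main.v *)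
Require Import Defs.
From HB Require Import structures.
From mathcomp Require Import all_boot all_order all_algebra.
From mathcomp Require Import all_classical all_reals all_analysis.
From mathcomp Require Import measurable_realfun lra.

(** The total reward is a nonnegative combination of lengths of sets of the
form D `&` (union of the service zones of a family), one family per quality
threshold, because the rate is a nonincreasing function of the best scale
([layer_weights], [captured_reward_layers]).  The length that such a family
leaves uncovered in ]a, b[ is a sum of terms
max(0, min of some left ends - max of some right ends), one for each way of
splitting the family into zones right of the point and zones left of the
point; this is [uncovered].

A difference (min of left ends) - (max of right ends) is concave in the
positions, and its positive part stays concave as long as its sign cannot
change.  So the reward is convex along any motion during which no right end
of a zone (or left end of a demand zone) crosses a left end of a zone (or
right end of a demand zone): [total_reward_midpoint].  Two left ends, or
two right ends, may cross freely, which is why only the inner and outer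
critical values appear in the theorem.

A maximizer exists by compactness ([exists_optimal]).  Suppose that the zones
of a sequence s are already at admissible positions.  Fix them and translate
all the other zones rigidly by a common t.  The crossings that can occur are
exactly the events where a moving zone meets a critical value relative to s.
If t is the offset of smallest modulus to such a value, then no crossing
occurs between the translations by -t and t, so convexity gives
2 f(x) <= f(x + t) + f(x - t); as x is optimal, so is x + t
([optimal_shift]).  In the translated solution one more zone is at an
admissible position, while those of s have not moved ([sequence_extend]).
Iterating places all the zones. *)

Set Implicit Arguments.
Unset Strict Implicit.
Unset Printing Implicit Defensive.

Import Order.TTheory GRing.Theory Num.Theory.
Import numFieldNormedType.Exports.

Local Open Scope classical_set_scope.
Local Open Scope ring_scope.

(** * Pairs of reals whose order is preserved *)

Section SameOrder.
Variable R : realDomainType.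
Implicit Types a b c t : R.

(** Weak inequalities on both sides: the pair may become or cease to be tied,
but cannot be strictly ordered in opposite ways at the two times. *)
Definition same_order a1 b1 a2 b2 :=
  (a1 <= b1 /\ a2 <= b2) \/ (b1 <= a1 /\ b2 <= a2).

Lemma same_orderC a1 b1 a2 b2 :
  same_order a1 b1 a2 b2 -> same_order b1 a1 b2 a2.
Proof. by case; [right|left]. Qed.

Lemma same_order_rigid a b t1 t2 :
  same_order (a + t1) (b + t1) (a + t2) (b + t2).
Proof.
by rewrite /same_order !lerD2r; case/orP: (le_total a b); [left|right].
Qed.

Lemma same_order_refl a b : same_order a b a b.
Proof. by case/orP: (le_total a b); [left|right]. Qed.

Lemma same_order_shift a b t :
  `|t| <= `|b - a| -> same_order (a + t) b (a - t) b.
Proof.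
move=> H; have := ler_norm t; have := ler_norm (- t); rewrite normrN => tl tr.
have [ab|ab] := leP a b; [left|right].
  by move: H; rewrite (@ger0_norm _ (b - a)) ?subr_ge0// => H; split; lra.
by move: H; rewrite (@ltr0_norm _ (b - a)) ?subr_lt0// => H; split; lra.
Qed.

Lemma same_order_max a1 b1 a2 b2 c1 c2 :
  same_order a1 b1 a2 b2 -> same_order c1 b1 c2 b2 ->
  same_order (Num.max a1 c1) b1 (Num.max a2 c2) b2.
Proof.
by case=> -[h1 h2] [[h3 h4]|[h3 h4]]; [left|right..]; split;
  rewrite ?ge_max ?le_max ?h1 ?h2 ?h3 ?h4 ?orbT.
Qed.

Lemma same_order_min a1 b1 a2 b2 c1 c2 :
  same_order a1 b1 a2 b2 -> same_order a1 c1 a2 c2 ->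
  same_order a1 (Num.min b1 c1) a2 (Num.min b2 c2).
Proof.
by case=> -[h1 h2] [[h3 h4]|[h3 h4]]; [left|right..]; split;
  rewrite ?ge_min ?le_min ?h1 ?h2 ?h3 ?h4 ?orbT.
Qed.

End SameOrder.

(** * The length left uncovered by a family of segments *)

Section Uncovered.
Variables (R : realType) (T : choiceType).
Implicit Types (l r : T -> R) (s : seq T).

(** A point of ]a, b[ outside [l j, r j] lies left of l j or right of r j;
the recursion runs over these choices and ends in the lengths of intervals. *)
Fixpoint uncovered l r s (a b : R) : R :=
  if s is j :: s' then
    uncovered l r s' a (Num.min b (l j)) + uncovered l r s' (Num.max a (r j)) b
  else Num.max 0 (b - a).

Lemma measure_uncovered l r s a b : (forall j, l j <= r j) ->
  lebesgue_measure (`]a, b[%classic `\`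
    \bigcup_(j in [set` s]) `[l j, r j]%classic) = (uncovered l r s a b)%:E.
Proof.
move=> lr; elim: s a b => [|j s IHs] a b.
  rewrite set_nil bigcup_set0 setD0 lebesgue_measure_itv /=.
  rewrite lte_fin; case: ltP => ab.
    by rewrite max_r ?subr_ge0 1?ltW// EFinB.
  by rewrite max_l// subr_le0.
set U := \bigcup_(i in [set` s]) _ in IHs.
have -> : `]a, b[%classic `\` \bigcup_(i in [set` j :: s]) `[l i, r i]%classic =
    (`]a, Num.min b (l j)[%classic `\` U) `|`
    (`]Num.max a (r j), b[%classic `\` U).
  rewrite bigcup_seq big_cons -bigcup_seq -/U -setDDl -setDUl; congr (_ `\` _).
  apply/seteqP; split => u /=; rewrite !in_itv /= !lt_min !gt_max.
    move=> [/andP[-> ->]] /negP; rewrite negb_and -!ltNge.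
    by case/orP => ->; [left|right].
  case=> /andP[]; [move=> -> /andP[-> ul]|move=> /andP[-> ru] ->]; split=> //;
    by apply/negP; rewrite negb_and -!ltNge ?ul ?ru ?orbT.
have mU : measurable U.
  by rewrite /U bigcup_seq; apply: bigsetU_measurable => i _;
    exact: measurable_itv.
rewrite measureU; first by rewrite /= EFinD -!IHs.
- by apply: measurableD => //; exact: measurable_itv.
- by apply: measurableD => //; exact: measurable_itv.
- apply/seteqP; split => // u /=; rewrite !in_itv /= lt_min gt_max.
  move=> [[/andP[_ /andP[_ ul]] _] [/andP[/andP[_ ru] _] _]].
  by have := lt_le_trans ul (lr j); rewrite ltNge ltW.
Qed.

(** The index 1 and 2 configurations are the ends of a motion with midpoint l,
r, a, b.  Each summand of [uncovered] is the positive part of a concave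
function, and [same_order] forces this function to have the same weak sign at
both ends: either it is nonnegative at both, where it then equals its positive
part, or its positive part is zero at both.  In the recursion a becomes a
maximum and b a minimum, which satisfy the midpoint relation only as
inequalities. *)
Lemma uncovered_midpoint l r l1 r1 l2 r2 s a b a1 b1 a2 b2 :
  (forall j, l1 j + l2 j = 2 * l j) -> (forall j, r1 j + r2 j = 2 * r j) ->
  2 * a <= a1 + a2 -> b1 + b2 <= 2 * b ->
  same_order a1 b1 a2 b2 ->
  (forall j, same_order a1 (l1 j) a2 (l2 j)) ->
  (forall j, same_order (r1 j) b1 (r2 j) b2) ->
  (forall j k, same_order (r1 j) (l1 k) (r2 j) (l2 k)) ->
  uncovered l1 r1 s a1 b1 + uncovered l2 r2 s a2 b2 <= 2 * uncovered l r s a b.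
Proof.
move=> lm rm + + + + + rl.
elim: s a b a1 b1 a2 b2 => [|j s IHs] a b a1 b1 a2 b2 am bm ab al rb /=.
  case: ab => -[ab1 ab2].
    rewrite (max_r (y := b1 - a1)) ?subr_ge0//.
    rewrite (max_r (y := b2 - a2)) ?subr_ge0//.
    have : b - a <= Num.max 0 (b - a) by rewrite le_max lexx orbT.
    lra.
  rewrite (max_l (y := b1 - a1)) ?subr_le0//.
  rewrite (max_l (y := b2 - a2)) ?subr_le0// addr0.
  by rewrite mulr_ge0// le_max lexx.
rewrite mulrDr addrACA lerD//.
- apply: IHs => //.
  + by have := lm j; case: (leP b (l j)); case: (leP b1 (l1 j));
      case: (leP b2 (l2 j)); lra.
  + exact: same_order_min.
  + by move=> k; exact: same_order_min.
- apply: IHs => //.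
  + by have := rm j; case: (leP a (r j)); case: (leP a1 (r1 j));
      case: (leP a2 (r2 j)); lra.
  + exact: same_order_max.
  + by move=> k; exact: same_order_max.
Qed.

End Uncovered.

Lemma uncovered_continuous (R : realType) (T : choiceType) (X : topologicalType)
    (l r : X -> T -> R) (s : seq T) (a b : X -> R) :
  (forall j, continuous (l ^~ j)) -> (forall j, continuous (r ^~ j)) ->
  continuous a -> continuous b ->
  continuous (fun x => uncovered (l x) (r x) s (a x) (b x)).
Proof.
move=> cl cr; elim: s a b => [|j s IHs] a b ca cb x /=.
  apply: (@continuous_max R X (cst 0) (fun y => b y - a y)); first exact: cvg_cst.
  by apply: continuousB; [exact: cb|exact: ca].
apply: (@continuousD _ R^o X); apply: IHs => // y.
- by apply: (@continuous_min R X b (l ^~ j)); [exact: cb|exact: cl].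
- by apply: (@continuous_max R X a (r ^~ j)); [exact: ca|exact: cr].
Qed.

(** * Decomposition of a nonincreasing reward into thresholds *)

(** Layer-cake decomposition of a nonnegative g that is a nonincreasing function
of f.  The indices are added in decreasing order of f.  A new index i has the
smallest f so far, so its weight does not enter the sums for larger values of
f, while the sum for i runs over all the indices present; the weight of i is
therefore the difference between g i and the sum of the older weights, which
is an older value of g (or 0), hence at most g i. *)
Lemma layer_weights (R : realDomainType) (J : finType) (f g : J -> R) :
  (forall j, 0 <= g j) -> (forall j k, f j <= f k -> g k <= g j) ->
  exists c : J -> R, (forall j, 0 <= c j) /\
    forall k, \sum_(j | f k <= f j) c j = g k.
Proof.
move=> g0 fg.
suff H (A : {set J}) : exists c : J -> R, (forall j, 0 <= c j) /\
    forall k, k \in A -> \sum_(j in A | f k <= f j) c j = g k.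
  have [c [c0 cg]] := H [set: J]%SET; exists c; split => // k.
  by rewrite -(cg k) ?finset.in_setT//; apply: eq_bigl => j;
    rewrite finset.in_setT.
have [m] := ubnP #|A|; elim: m A => // m IHm A; rewrite ltnS => Am.
have [->|[k0 k0A]] := finset.set_0Vmem A.
  by exists (fun=> 0); split => // k; rewrite inE.
case: (arg_minP f k0A) => i; rewrite -/(i \in A) => iA imin.
have [|c [c0 cg]] := IHm (A :\ i)%SET.
  by rewrite (leq_trans _ Am)// [leqRHS](cardsD1 i) iA.
have sum_le : \sum_(j in (A :\ i)%SET) c j <= g i.
  have [->|[k1 k1A]] := finset.set_0Vmem (A :\ i)%SET.
    by rewrite big1// => j; rewrite inE.
  case: (arg_minP f k1A) => k; rewrite -/(k \in (A :\ i)%SET) => kA kmin.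
  have -> : \sum_(j in (A :\ i)%SET) c j = g k.
    rewrite -cg//; apply: eq_bigl => j.
    by case: (boolP (j \in _)) => // /kmin ->.
  by apply/fg/imin; move: kA; rewrite !inE => /andP[].
exists (fun j => if j == i then g i - \sum_(j in (A :\ i)%SET) c j else c j).
split=> [j|k kA]; first by case: ifP => // _; rewrite subr_ge0.
have [fki|fik] := leP (f k) (f i).
  have -> : g k = g i by apply/le_anti; rewrite !fg// imin.
  rewrite (bigD1 i) /= ?iA//; rewrite eqxx.
  rewrite [X in _ + X](_ : _ = \sum_(j in (A :\ i)%SET) c j) ?subrK//.
  apply: eq_big => [j|j /andP[_ /negbTE ->]//].
  rewrite !inE andbC; case: eqP => //= _; case: (boolP (j \in A)) => //= jA.
  exact: le_trans fki (imin _ jA).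
rewrite -(cg k); last first.
  by rewrite !inE kA andbT; apply: contraTneq fik => ->; rewrite ltxx.
apply: eq_big => [j|j /andP[_ kj]].
  by rewrite !inE; have [->|//] := eqVneq j i; rewrite leNgt fik andbF.
by case: eqP kj => // ->; rewrite leNgt fik.
Qed.

(** * The reward as a combination of covered lengths *)

Section Reward.
Variables (R : realType) (n p : nat) (I : instance R n p).
Implicit Types (x y : 'I_p -> R) (s : seq 'I_p).

Let width j := scale I j * base_width I.
Let right_end x j := x j + width j.
Let dz_right i := dz_left I i + dz_width I i.

Definition layer (j : 'I_p) := [seq k <- enum 'I_p | scale I k <= scale I j].

(** The demand zone is taken open so that [measure_uncovered] applies; the end
points have measure zero. *)
Definition covered_set x s i : set R :=
  `]dz_left I i, dz_left I i + dz_width I i[%classic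
    `&` \bigcup_(k in [set` s]) service_zone I x k.

Definition covered_length x s i : R :=
  fine (lebesgue_measure (covered_set x s i)).

Lemma width_ge0 j : 0 <= width j.
Proof. by rewrite mulr_ge0 ?base_width_ge0// (le_trans ler01)// scale_ge1. Qed.

Lemma best_scaleE x u k : service_zone I x k u ->
  (forall j, service_zone I x j u -> scale I k <= scale I j) ->
  best_scale I x u = scale I k.
Proof.
move=> xku kmin; apply/le_anti/andP; split.
  apply: ge_inf; last by exists k.
  by exists (scale I k) => _ [j /kmin kj <-].
apply: lb_le_inf; first by exists (scale I k), k.
by move=> _ [j /kmin kj <-].
Qed.

Lemma measurable_zones x s :
  measurable (\bigcup_(k in [set` s]) service_zone I x k).
Proof.
by rewrite bigcup_seq; apply: bigsetU_measurable => i _; exact: measurable_itv.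
Qed.

Lemma measurable_covered_set x s i : measurable (covered_set x s i).
Proof.
by apply: measurableI; [exact: measurable_itv|exact: measurable_zones].
Qed.

Lemma covered_set_fin_num x s i :
  lebesgue_measure (covered_set x s i) \is a fin_num.
Proof.
rewrite ge0_fin_numE ?measure_ge0//.
pose D : set R := `]dz_left I i, dz_left I i + dz_width I i[%classic.
apply: (@le_lt_trans _ _ (lebesgue_measure D)).
  by apply: measureIl; [exact: measurable_itv|exact: measurable_zones].
by rewrite lebesgue_measure_itv/=; case: ifP => // _; rewrite -EFinB ltry.
Qed.

(** Weights that do not depend on x, so that all properties of the reward as a
function of the positions reduce to those of covered lengths. *)
Lemma captured_reward_layers i : exists c : 'I_p -> R, (forall j, 0 <= c j) /\
  forall x, captured_reward I x i = \sum_j c j * covered_length x (layer j) i.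
Proof.
have [||c [c0 cE]] :=
  @layer_weights R 'I_p (scale I) (fun j => rate I i (scale I j)).
- by move=> j; rewrite divr_ge0 ?base_rate_ge0// ltW// eta_gt0// scale_ge1.
- move=> j k; rewrite le_eqVlt => /predU1P[->//|jk].
  rewrite ler_wpM2l ?base_rate_ge0// lef_pV2 ?posrE ?eta_gt0 ?scale_ge1//.
  by rewrite ltW// eta_increasing// scale_ge1.
exists c; split => // x.
pose K j := \bigcup_(k in [set` layer j]) service_zone I x k.
have mK j : measurable (K j) by exact: measurable_zones.
have rateE u : ((fun u => rate I i (best_scale I x u)) \_
    (\bigcup_j service_zone I x j)) u = \sum_j c j * \1_(K j) u.
  rewrite patchE; case: ifPn => [|/negP]; rewrite inE.
    (* A point covered with best scale z lies in the union of layer j exactly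
       when z <= scale j, so the weights add up to the rate at z. *)
    move=> [k0 _ k0u].
    have k0u' : `[< service_zone I x k0 u >] by apply/asboolP.
    case: (@arg_minP _ _ _ k0 (fun k => `[< service_zone I x k u >])
      (scale I) k0u') => k /asboolP ku kmin.
    rewrite (best_scaleE ku); last by move=> j ju; apply: kmin; apply/asboolP.
    rewrite -cE [LHS]big_mkcond; apply: eq_bigr => j _; rewrite indicE.
    case: ifPn => kj.
      by rewrite mem_set ?mulr1//; exists k => //=;
        rewrite mem_filter kj mem_enum.
    rewrite memNset ?mulr0// => -[l /=]; rewrite mem_filter => /andP[lj _] lu.
    by case/negP: kj; apply: le_trans lj; apply: kmin; apply/asboolP.
  move=> nu; rewrite big1// => j _; rewrite indicE memNset ?mulr0// => -[l _ lu].
  by apply: nu; exists l.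
rewrite /captured_reward Rintegral_mkcondr /Rintegral.
under eq_integral do rewrite rateE.
rewrite integral_itv_bndoo; last first.
  apply/measurable_EFinP/measurable_sum => j; exact: measurable_funM.
under eq_integral do rewrite -sumEFin.
rewrite ge0_integral_sum//; last 2 first.
- move=> j; apply/measurable_EFinP; apply: measurable_funM => //.
  exact: (measurable_indic (mK j)).
- by move=> j u _; rewrite lee_fin mulr_ge0.
rewrite (eq_bigr (fun j => (c j * covered_length x (layer j) i)%:E)).
  by rewrite sumEFin.
move=> j _; under eq_integral do rewrite EFinM.
rewrite ge0_integralZl ?lee_fin//.
- rewrite integral_indic; [|exact: measurable_itv|exact: mK].
  by rewrite setIC EFinM fineK//; exact: covered_set_fin_num.
- by apply/measurable_EFinP; exact: (measurable_indic (mK j)).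
Qed.

Lemma covered_lengthE x s i : covered_length x s i = dz_width I i -
  uncovered x (right_end x) s (dz_left I i) (dz_right i).
Proof.
have D : lebesgue_measure `]dz_left I i, dz_left I i + dz_width I i[%classic
    = (dz_width I i)%:E.
  rewrite lebesgue_measure_itv/= lte_fin ltrDl lt_neqAle dz_width_ge0 andbT.
  by case: eqVneq => [<-//|_] /=; rewrite -EFinB addrAC subrr add0r.
set D0 := `]_, _[%classic in D *; rewrite /covered_length /covered_set -/D0.
have mK := measurable_zones x s.
have xr k : x k <= right_end x k by rewrite lerDl width_ge0.
have : (lebesgue_measure D0 = lebesgue_measure (D0 `\`
    \bigcup_(k in [set` s]) service_zone I x k) + lebesgue_measure (D0 `&`
    \bigcup_(k in [set` s]) service_zone I x k))%E.
  by apply: measureDI; [exact: measurable_itv|exact: mK].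
rewrite D (measure_uncovered _ _ _ xr).
by case: (lebesgue_measure _) => [y [] wE|//|//] /=; rewrite /dz_right; lra.
Qed.

Lemma total_reward_le x y :
  (forall i j, `]dz_left I i, dz_right i[%classic `&` service_zone I x j
     `<=` service_zone I y j) ->
  total_reward I x <= total_reward I y.
Proof.
move=> xy; apply: ler_sum => i _.
have [c [c0 cE]] := captured_reward_layers i; rewrite !cE.
apply: ler_sum => j _; rewrite ler_wpM2l//.
apply: fine_le; [exact: covered_set_fin_num|exact: covered_set_fin_num|].
apply: le_measure; rewrite ?inE; [exact: measurable_covered_set..|].
by move=> u [Du [k kj ku]]; split => //; exists k => //; exact: (xy i).
Qed.

(** * Existence of an optimal solution *)

Lemma total_reward_continuous :
  continuous (fun v : 'rV[R]_p => total_reward I (v ord0)).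
Proof.
rewrite /total_reward; apply: continuous_big => [|i _].
  exact: add_continuous.
have [c [_ cE]] := captured_reward_layers i.
rewrite [X in continuous X](_ : _ = fun v : 'rV[R]_p =>
    \sum_j c j * covered_length (v ord0) (layer j) i);
  last by apply/funext => v; exact: cE.
apply: continuous_big => [|j _]; first exact: add_continuous.
pose unc (v : 'rV[R]_p) := uncovered (v ord0) (right_end (v ord0)) (layer j)
  (dz_left I i) (dz_right i).
rewrite [X in continuous X](_ : _ = cst (c j) \* (cst (dz_width I i) - unc));
  last by apply/funext => v; rewrite covered_lengthE.
have coord k : continuous (fun v : 'rV[R]_p => v ord0 k).
  exact: coord_continuous.
have cunc : continuous unc.
  apply: (@uncovered_continuous R 'I_p 'rV[R]_p (fun v => v ord0)
    (fun v => right_end (v ord0))).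
  - exact: coord.
  - move=> k u.
    apply: (@continuousD _ R^o 'rV[R]_p (fun v => v ord0 k) (cst (width k))).
      exact: coord.
    exact: cst_continuous.
  - by move=> u; exact: cst_continuous.
  - by move=> u; exact: cst_continuous.
move=> v; apply: continuousM; first exact: cst_continuous.
by apply: (@continuousB _ R^o); [exact: cst_continuous|exact: cunc].
Qed.

(** The box [-M, M]^p is large enough that a zone whose left end lies outside
[-M, M] meets no open demand zone; such a zone can be moved to 0 without loss. *)
Lemma exists_optimal : exists x, optimal I x.
Proof.
pose M := \sum_i (`|dz_left I i| + `|dz_right i|) + \sum_j width j.
have M0 : 0 <= M.
  by rewrite addr_ge0// sumr_ge0// => i _; rewrite ?addr_ge0 ?width_ge0.
have Md i j : `|dz_left I i| + `|dz_right i| + width j <= M.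
  rewrite lerD//.
    by rewrite (bigD1 i)//= lerDl sumr_ge0// => *; rewrite addr_ge0.
  by rewrite (bigD1 j)//= lerDl sumr_ge0// => *; rewrite width_ge0.
pose A := [set v : 'rV[R]_p | forall j, `[- M, M]%classic (v ord0 j)].
have [|||v _ vmax] := @EVT_max_rV R p (fun v => total_reward I (v ord0)) A.
- by exists (const_mx 0) => j /=; rewrite mxE in_itv/= oppr_le0 M0.
- apply: (@rV_compact R p (fun=> `[- M, M]%classic)) => j.
  exact: segment_compact.
- exact: continuous_subspaceT total_reward_continuous.
exists (v ord0) => y.
pose y' := \row_j (if y j \in `[- M, M] then y j else 0).
have y'A : y' \in A.
  apply/mem_set => j /=; rewrite mxE; case: ifP => // _.
  by rewrite in_itv/= oppr_le0 M0.
apply: le_trans (vmax _ y'A); apply: total_reward_le => i j u.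
rewrite /service_zone /= mxE !in_itv/= => -[/andP[lu ur] /andP[yu uy]].
case: ifPn => [|/negP[]]; first by rewrite yu.
have := Md i j; have := width_ge0 j.
have := ler_norm (dz_right i); have := ler_norm (- dz_left I i).
have := normr_ge0 (dz_right i); have := normr_ge0 (dz_left I i).
rewrite normrN /width => *; apply/andP; split; lra.
Qed.

(** * Convexity of the reward between crossings *)

Lemma total_reward_midpoint x x1 x2 : (forall j, x1 j + x2 j = 2 * x j) ->
  (forall i k, same_order (dz_left I i) (x1 k) (dz_left I i) (x2 k)) ->
  (forall i j,
    same_order (right_end x1 j) (dz_right i) (right_end x2 j) (dz_right i)) ->
  (forall j k, same_order (right_end x1 j) (x1 k) (right_end x2 j) (x2 k)) ->
  2 * total_reward I x <= total_reward I x1 + total_reward I x2.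
Proof.
move=> xm lx xr xx; rewrite mulr_sumr -big_split; apply: ler_sum => i _ /=.
have [c [c0 cE]] := captured_reward_layers i; rewrite !cE.
rewrite mulr_sumr -big_split; apply: ler_sum => j _ /=.
rewrite mulrCA -mulrDr ler_wpM2l// !covered_lengthE.
have := @uncovered_midpoint R 'I_p x (right_end x)
  x1 (right_end x1) x2 (right_end x2) (layer j)
  (dz_left I i) (dz_right i) (dz_left I i) (dz_right i)
  (dz_left I i) (dz_right i) xm _ _ _ _ (lx i) (xr i) xx.
rewrite /right_end/width /dz_right => H.
have := dz_width_ge0 I i => w0.
suff: forall a b c d : R, a + b <= 2 * c -> 2 * (d - c) <= d - a + (d - b).
  apply; apply: H.
  - by move=> k; have := xm k; lra.
  - lra.
  - lra.
  - by left; split; rewrite lerDl.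
move=> *; lra.
Qed.

(** * Critical values and rigid translations *)

Definition critical x (J : set 'I_p) u : set R :=
  inner_DZ_critical I (scale I u) `|` outer_SZ_critical I x J (scale I u).

(** A finite type of names for the critical values of zone u, over which a
nearest one can be selected. *)
Definition critical_value x u (c : ('I_n + 'I_p) * bool) : R :=
  match c with
  | (inl i, false) => dz_left I i
  | (inl i, true) => dz_left I i + dz_width I i - base_width I * scale I u
  | (inr j, false) => x j - base_width I * scale I u
  | (inr j, true) => x j + base_width I * scale I j
  end.

Lemma critical_valueP x s u c :
  (if c.1 is inr j then j \in s else true) ->
  critical x [set` s] u (critical_value x u c).
Proof.
case: c => [[i|j] []] /= cs.
- by left; exists i => //; right.
- by left; exists i => //; left.
- by right; exists j => //; right.
- by right; exists j => //; left.
Qed.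

Definition shift s t x j := x j + (if j \in s then 0 else t).

(** A pair consisting of a moving and a fixed end point differs, at x, by the
distance from the moving zone to a critical value, so a translation by at most
that distance, in either direction, does not make it cross. *)
Lemma optimal_shift x s t : optimal I x ->
  (forall u c, u \notin s -> (if c.1 is inr j then j \in s else true) ->
    `|t| <= `|critical_value x u c - x u|) ->
  optimal I (shift s t x).
Proof.
move=> xopt tmin.
suff H : 2 * total_reward I x <=
    total_reward I (shift s t x) + total_reward I (shift s (- t) x).
  move=> y; apply: le_trans (xopt y) _.
  by have := xopt (shift s (- t) x); lra.
apply: total_reward_midpoint => [j|i k|i j|j k]; rewrite /right_end /shift.
- by case: ifP => _; lra.
- case: ifPn => ks; first exact: same_order_refl.
  by apply/same_orderC/same_order_shift/(tmin k (inl i, false)).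
- case: ifPn => js; first exact: same_order_refl.
  rewrite [_ + t + _]addrAC [_ - t + _]addrAC; apply: same_order_shift.
  have := tmin j (inl i, true) js isT; rewrite /= /width /dz_right.
  by rewrite mulrC opprD addrA addrAC.
- case: ifPn => js; case: ifPn => ks; rewrite ?addr0.
  + exact: same_order_refl.
  + apply/same_orderC/same_order_shift.
    by have := tmin k (inr j, true) ks js; rewrite /= /width mulrC.
  + rewrite [_ + t + _]addrAC [_ - t + _]addrAC; apply: same_order_shift.
    have := tmin j (inr k, false) js ks; rewrite /= /width.
    by rewrite mulrC opprD addrA addrAC.
  + rewrite [_ + t + _]addrAC [_ - t + _]addrAC; exact: same_order_rigid.
Qed.

(** * Building the sequence *)

Definition sequenced u0 x s := forall m, (m < size s)%N ->
  critical x [set` take m s] (nth u0 s m) (x (nth u0 s m)).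

Lemma critical_sub x y (J K : set 'I_p) u :
  J `<=` K -> (forall j, J j -> x j = y j) ->
  critical x J u `<=` critical y K u.
Proof.
move=> JK xy v [?|[j Jj vj]]; [by left|right; exists j; first exact: JK].
by rewrite -xy.
Qed.

Lemma sequenced_rcons u0 x y s u : {in s, x =1 y} -> sequenced u0 x s ->
  critical x [set` s] u (y u) -> sequenced u0 y (rcons s u).
Proof.
move=> xy xs yu m; rewrite size_rcons ltnS leq_eqVlt => /predU1P[->|ms].
  rewrite nth_rcons ltnn eqxx -cats1 take_size_cat//.
  exact: critical_sub yu.
rewrite nth_rcons ms -cats1 takel_cat 1?ltnW//.
rewrite -xy ?mem_nth//; apply: critical_sub (xs m ms) => // j /mem_take.
exact: xy.
Qed.

Lemma sequence_extend u0 x s : (0 < n)%N -> optimal I x -> uniq s ->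
  sequenced u0 x s -> (size s < p)%N ->
  exists y u, [/\ optimal I y, uniq (rcons s u) & sequenced u0 y (rcons s u)].
Proof.
move=> n0 xopt us xs sp.
pose ok (d : 'I_p * (('I_n + 'I_p) * bool)) :=
  (d.1 \notin s) && (if d.2.1 is inr j then j \in s else true).
pose offset d := critical_value x d.1 d.2 - x d.1.
have [u1 u1s] : exists u, u \notin s.
  apply/existsP; rewrite -negb_forall; apply: contraL sp => /forallP sT.
  rewrite -leqNgt -[leqLHS]card_ord -(card_uniqP us) subset_leq_card//.
  by apply/fintype.subsetP => u _; exact: sT.
(* A demand zone provides an inner critical value, so there is a nearest one. *)
have ok1 : ok (u1, (inl (Ordinal n0), false)) by rewrite /ok u1s.
case: (@arg_minP _ _ _ _ ok (fun d => `|offset d|) ok1).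
move=> -[u c] /andP[/= us' cs] dmin.
exists (shift s (offset (u, c)) x), u; split.
- by apply: optimal_shift => // v e vs es; apply: (dmin (v, e)); rewrite /ok vs.
- by rewrite rcons_uniq us'.
- apply: sequenced_rcons xs _ => [j js|]; first by rewrite /shift js addr0.
  rewrite /shift (negbTE us') /offset /= addrC subrK.
  exact: critical_valueP.
Qed.

End Reward.

Theorem theorem3 (R : realType) (n p : nat) (n_gt0 : (0 < n)%N)
    (p_gt0 : (0 < p)%N) (I : instance R n p) :
  exists x : 'I_p -> R,
    optimal I x /\
    exists t : 'I_p -> 'I_p,
      [/\ injective t,
          x (t (Ordinal p_gt0))
            \in inner_DZ_critical I (scale I (t (Ordinal p_gt0)))
        & forall k : 'I_p, (0 < k)%N ->
            x (t k) \in
              inner_DZ_critical I (scale I (t k)) `|`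
              outer_SZ_critical I x (t @` [set l : 'I_p | (l < k)%N])
                (scale I (t k))].
Proof.
pose u0 := Ordinal p_gt0.
have [x [s [xopt us sp xs]]] : exists x s,
    [/\ optimal I x, uniq s, size s = p & sequenced I u0 x s].
  suff H m : (m <= p)%N -> exists x s,
    [/\ optimal I x, uniq s, size s = m & sequenced I u0 x s] by exact: H.
  elim: m => [_|m IHm mp].
    by have [x xopt] := exists_optimal I; exists x, [::].
  have [x [s [xopt us sm xs]]] := IHm (ltnW mp).
  have [|y [u [yopt uu yu]]] := sequence_extend n_gt0 xopt us xs.
    by rewrite sm.
  by exists y, (rcons s u); rewrite size_rcons sm.
exists x; split => //; exists (fun k => nth u0 s k); split.
- by move=> k l /eqP; rewrite nth_uniq ?sp// => /eqP /val_inj.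
- apply/mem_set; have := xs 0%N; rewrite sp take0 => /(_ p_gt0) [//|[j]].
  by [].
- move=> k _; apply/mem_set.
  have ks : (k < size s)%N by rewrite sp.
  apply: critical_sub (xs k ks) => // j /= /(nthP u0)[l].
  rewrite size_takel ?(ltnW ks)// => lk; rewrite nth_take// => <-.
  by exists (Ordinal (ltn_trans lk (ltn_ord k))).
Qed.
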